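(* Let $(A, d_1, \ldots, d_N)$ be an AssHDer pair of rank $N$ and let $(\mu_t; d_{1,t}, \ldots, d_{N,t})$ be a deformation of order $n$ of it. Then this deformation is extensible if and only if the corresponding obstruction class $[(\mathrm{Ob}; \mathrm{Ob}_1, \ldots, \mathrm{Ob}_N)] \in H^3_{\mathrm{AssHDer}}(A, A)$ is zero.
   Context: All vector spaces and linear maps are over a field $\mathbb{K}$ of characteristic zero. Algebras are associative, not assumed unital. Fix an integer $N \ge 1$. A higher derivation of rank $N$ on an associative algebra $A$ is a sequence $\{d_1, \ldots, d_N\}$ of linear maps $A \to A$ with $d_k(ab) = \sum_{i+j=k} d_i(a) d_j(b)$ for $1 \le k \le N$, $a,b\in A$, where $i,j\ge 0$ and $d_0 = \mathrm{id}_A$. An AssHDer pair of rank $N$ is a tuple $(A, d_1, \ldots, d_N)$ of an associative algebra and a higher derivation of rank $N$ on it. Write $\mu$ for the multiplication of $A$. Cohomology with coefficients in itself ($M = A$ with its own multiplication as bimodule actions and $d_k^M = d_k$). For $f \in \mathrm{Hom}(A^{\otimes n}, A)$, $n\ge 1$, $\delta_{\mathrm{Hoch}} f$ is the Hochschild coboundary $(\delta_{\mathrm{Hoch}} f)(a_1, \ldots, a_{n+1}) = a_1 f(a_2, \ldots, a_{n+1}) + \sum_{i=1}^n (-1)^i f(a_1, \ldots, a_i a_{i+1}, \ldots, a_{n+1}) + (-1)^{n+1} f(a_1, \ldots, a_n) a_{n+1}$, and $\delta_k f = \sum_{i_1 + \cdots + i_n = k,\ i_l\ge 0} f \circ (d_{i_1}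 \otimes \cdots \otimes d_{i_n}) - d_k \circ f$ for $1\le k\le N$. For a tuple $(f_1, \ldots, f_N)$ in $\mathrm{Hom}(A^{\otimes n}, A)$ and $1\le k\le N$, $\delta'_{\mathrm{Hoch}}(f_k)(a_1, \ldots, a_{n+1}) = \sum_{i+j=k,\ i \ge 0,\ j \ge 1} d_i(a_1) f_j(a_2, \ldots, a_{n+1}) + \sum_{i=1}^n (-1)^i f_k(a_1, \ldots, a_i a_{i+1}, \ldots, a_{n+1}) + (-1)^{n+1} \sum_{i+j=k,\ i \ge 1,\ j \ge 0} f_i(a_1, \ldots, a_n) d_j(a_{n+1})$. Set $C^0_{\mathrm{AssHDer}}(A,A) = 0$, $C^1_{\mathrm{AssHDer}}(A, A) = \mathrm{Hom}(A, A)$, and $C^n_{\mathrm{AssHDer}}(A, A) = \mathrm{Hom}(A^{\otimes n}, A) \times \mathrm{Hom}(A^{\otimes n-1}, A)^{N}$ for $n \ge 2$. The differential is $\partial f = (\delta_{\mathrm{Hoch}} f; -\delta_1 f, \ldots, -\delta_N f)$ for $f\in C^1$, and $\partial(f; f_1, \ldots, f_N) = (\delta_{\mathrm{Hoch}} f; \delta'_{\mathrm{Hoch}} f_1 + (-1)^n \delta_1 f, \ldots, \delta'_{\mathrm{Hoch}} f_N + (-1)^n \delta_N f)$ for $(f; f_1, \ldots, f_N) \in C^n$, $n \ge 2$. $H^\ast_{\mathrm{AssHDer}}(A, A)$ is the cohomology of this complex. A deformation of order $n$ of $(A, d_1, \ldots, d_N)$ consists of sums $\mu_t = \sum_{i=0}^n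 t^i \mu_i$, $d_{k,t} = \sum_{i=0}^n t^i d_{k,i}$ ($1\le k\le N$), with $\mu_i \in \mathrm{Hom}(A^{\otimes 2}, A)$, $d_{k,i} \in \mathrm{Hom}(A,A)$, $\mu_0 = \mu$, $d_{k,0} = d_k$, such that $(A[[t]]/(t^{n+1}), \mu_t, d_{1,t}, \ldots, d_{N,t})$ is an AssHDer pair over $\mathbb{K}[[t]]/(t^{n+1})$. It is extensible if there exists $(\mu_{n+1}; d_{1,n+1}, \ldots, d_{N,n+1}) \in C^2_{\mathrm{AssHDer}}(A,A)$ such that $(\mu_t + t^{n+1}\mu_{n+1}; d_{1,t} + t^{n+1} d_{1,n+1}, \ldots, d_{N,t} + t^{n+1} d_{N,n+1})$ is a deformation of order $n+1$. The obstruction cocycle of a deformation of order $n$ is the $3$-cocycle $(\mathrm{Ob}; \mathrm{Ob}_1, \ldots, \mathrm{Ob}_N)\in C^3_{\mathrm{AssHDer}}(A,A)$ given by $\mathrm{Ob}(a,b,c) = \sum_{p+q=n+1,\ p,q>0} ( \mu_p(\mu_q(a,b),c) - \mu_p(a,\mu_q(b,c)))$ and $\mathrm{Ob}_k(a,b) = \sum_{p+q=n+1,\ p,q>0} d_{k,p}(\mu_q(a,b)) - \sum_{i+j=k} \sum_{p+q+r=n+1,\ 0\le p,q,r\le n} \mu_p(d_{i,q}(a), d_{j,r}(b))$, where $i,j\ge 0$, $d_{0,0} = \mathrm{id}_A$ and $d_{0,q}=0$ for $q>0$. Its cohomology class is the obstruction class. *)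

(* Defs.v *)
From HB Require Import structures.
From mathcomp Require Import all_boot all_algebra.
From mathcomp Require Import boolp functions zify.

Set Implicit Arguments.
Unset Strict Implicit.
Unset Printing Implicit Defensive.

Import GRing.Theory.
Local Open Scope ring_scope.

Section LinearProp.
Context (R : pzRingType) (U V : lmodType R).
Implicit Types f g : U -> V.

Lemma plinD f : linear f -> {morph f : x y / x + y}.
Proof. by move=> lf x y; have := lf 1 x y; rewrite !scale1r. Qed.

Lemma plin0 f : linear f -> f 0 = 0.
Proof.
by move=> lf; apply: (@addIr _ (f 0)); rewrite -(plinD lf) addr0 add0r.
Qed.

Lemma plinZ f a x : linear f -> f (a *: x) = a *: f x.
Proof. by move=> lf; rewrite -[a *: x]addr0 lf (plin0 lf) addr0. Qed.

Lemma plinN f x : linear f -> f (- x) = - f x.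
Proof. by move=> lf; rewrite -scaleN1r (plinZ _ _ lf) scaleN1r. Qed.

Lemma plinB f x y : linear f -> f (x - y) = f x - f y.
Proof. by move=> lf; rewrite (plinD lf) (plinN _ lf). Qed.

Lemma plin_sum f I (r : seq I) (P : pred I) (F : I -> U) : linear f ->
  f (\sum_(i <- r | P i) F i) = \sum_(i <- r | P i) f (F i).
Proof. by move=> lf; apply: big_morph; [exact: plinD|exact: plin0]. Qed.

Lemma lin_add f g : linear f -> linear g -> linear (fun u => f u + g u).
Proof. by move=> lf lg a u v; rewrite lf lg scalerDr addrACA. Qed.

Lemma lin_sum I (r : seq I) (P : pred I) (F : I -> U -> V) :
  (forall i, P i -> linear (F i)) -> linear (fun u => \sum_(i <- r | P i) F i u).
Proof.
move=> lF a u v; rewrite scaler_sumr -big_split /=.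
by apply: eq_bigr => i Pi; rewrite lF.
Qed.

Lemma lin_opp f : linear f -> linear (fun u => - f u).
Proof. by move=> lf a u v; rewrite lf opprD scalerN. Qed.

Lemma lin_id : linear (@id U). Proof. by []. Qed.

Lemma lin_zero : linear (fun _ : U => 0 : V).
Proof. by move=> a u v; rewrite scaler0 addr0. Qed.

End LinearProp.

Lemma lin_comp (R : pzRingType) (U V W : lmodType R) (f : V -> W) (g : U -> V) :
  linear f -> linear g -> linear (fun u => f (g u)).
Proof. by move=> lf lg a u v; rewrite lg lf. Qed.

Lemma lin_scale (R : comPzRingType) (U V : lmodType R) c (f : U -> V) :
  linear f -> linear (fun u => c *: f u).
Proof. by move=> lf a u v; rewrite lf scalerDr !scalerA mulrC. Qed.

(* The index k : 'I_N stands for the subscript k.+1 of d_1, ..., d_N;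
   [with_id d] is the family d_0 = id, d_1, ..., d_N, indexed by 'I_N.+1. *)
Definition with_id (T : Type) (N : nat) (d : 'I_N -> T -> T) (i : 'I_N.+1) :
  T -> T := if unlift ord0 i is Some k then d k else id.

Section AssHDer.
Context (R : comNzRingType) (M : lmodType R) (N : nat).

Record is_asshder (mul : M -> M -> M) (d : 'I_N -> M -> M) : Prop := {
  ah_mul_linearl : forall b, linear (mul^~ b);
  ah_mul_linearr : forall a, linear (mul a);
  ah_mulA : associative mul;
  ah_der_linear : forall k, linear (d k);
  ah_leibniz : forall (k : 'I_N) a b, d k (mul a b) =
    \sum_(i < N.+1) \sum_(j < N.+1 | (i + j)%N == k.+1)
       mul (with_id d i a) (with_id d j b)
}.

End AssHDer.

(* Hom(A^{(x) n}, A) is rendered by n-linear maps ('I_n -> A) -> A. *)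

Section Hom.
Context (K : fieldType) (A : lmodType K) (n : nat).

Definition multilinear (f : ('I_n -> A) -> A) : Prop :=
  forall (x : 'I_n -> A) (i : 'I_n), linear (fun u => f [eta x with i |-> u]).

Definition multilinear_pred : {pred ('I_n -> A) -> A} :=
  [pred f | `[< multilinear f >]].

Fact multilinear_submod_closed : submod_closed multilinear_pred.
Proof.
split=> [|c f g /asboolP lf /asboolP lg]; apply/asboolP => x i.
  exact: lin_zero.
move=> a u v; exact: (lin_add (lin_scale c (lf x i)) (lg x i)).
Qed.

HB.instance Definition _ := GRing.isSubmodClosed.Build K (('I_n -> A) -> A)
  multilinear_pred multilinear_submod_closed.

Record hom := MkHom {
  hom_fun :> ('I_n -> A) -> A;
  _ : hom_fun \in multilinear_pred }.

HB.instance Definition _ := [isSub for hom_fun].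
HB.instance Definition _ := [Choice of hom by <:].
HB.instance Definition _ := [SubChoice_isSubLmodule of hom by <:].

Lemma hom_linear (f : hom) (x : 'I_n -> A) i :
  linear (fun u => f [eta x with i |-> u]).
Proof. by case: f => f /= /asboolP; apply. Qed.

Lemma homP (f g : hom) : f =1 g -> f = g.
Proof. by move=> fg; apply/val_inj/funext. Qed.

Lemma hom_addE (f g : hom) x : (f + g) x = f x + g x.
Proof. by []. Qed.

Lemma hom_scaleE c (f : hom) x : (c *: f) x = c *: f x.
Proof. by []. Qed.

Lemma hom_oppE (f : hom) x : (- f) x = - f x.
Proof. by []. Qed.

End Hom.

Section Cochain.
Context (K : fieldType) (A : lmodType K) (N : nat).

Definition cochain (n : nat) : lmodType K :=
  match n with
  | 0 => 'rV[K]_0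
  | 1 => hom A 1
  | m.+2 => (hom A m.+2 * {ffun 'I_N -> hom A m.+1})%type
  end.

(* An element c of C^2 is a tuple (mu; d_1, ..., d_N); [mul_of] and [der_of] are
   its components as maps of two, resp. one, arguments. *)
Definition mul_of (c : cochain 2) (a b : A) : A := c.1 (tnth [tuple a; b]).
Definition der_of (c : cochain 2) (k : 'I_N) (a : A) : A :=
  c.2 k (tnth [tuple a]).

Record asshder := AssHDer {
  asshder_val :> cochain 2;
  asshderP : is_asshder (mul_of asshder_val) (der_of asshder_val) }.

End Cochain.
Arguments cochain {K} A N n.
Arguments asshder {K} A N.

Section Update.
Context (A : Type).

Lemma upd_inj m n (h : 'I_m -> 'I_n) (x : 'I_n -> A) j u : injective h ->
  (fun l => [eta x with h j |-> u] (h l)) = [eta (fun l => x (h l)) with j |-> u].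
Proof. by move=> hI; apply/funext => l /=; rewrite (inj_eq hI). Qed.

Lemma upd_out m n (h : 'I_m -> 'I_n) (x : 'I_n -> A) i u :
  (forall l, h l != i) -> (fun l => [eta x with i |-> u] (h l)) = x \o h.
Proof. by move=> hi; apply/funext => l /=; rewrite (negPf (hi l)). Qed.

End Update.

Section Complex.
Context (K : fieldType) (A : lmodType K) (N : nat) (P : asshder A N).

Local Notation "a ** b" := (mul_of P a b) (at level 40, left associativity).
Local Notation d := (der_of P).
Local Notation dd := (with_id (der_of P)).

Lemma mul_linl b : linear (mul_of P ^~ b).
Proof. exact: (ah_mul_linearl (asshderP P)). Qed.
Lemma mul_linr a : linear (mul_of P a).
Proof. exact: (ah_mul_linearr (asshderP P)). Qed.
Lemma der_lin k : linear (d k).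
Proof. exact: (ah_der_linear (asshderP P)). Qed.
Lemma dd_lin i : linear (dd i).
Proof. by rewrite /with_id; case: unlift => [k|]; [exact: der_lin|]. Qed.

(* (a_0, ..., a_i a_{i+1}, ..., a_n); note that [lift ord_max] is the
   inclusion 'I_n -> 'I_n.+1 and [lift ord0] the successor map. *)
Definition contract n (x : 'I_n.+1 -> A) (i : 'I_n) (j : 'I_n) : A :=
  if (j < i)%N then x (lift ord_max j)
  else if j == i then x (lift ord_max i) ** x (lift ord0 i)
  else x (lift ord0 j).

(* The part common to the Hochschild coboundary and its primed variant. *)
Definition face_sum n (f : hom A n) (x : 'I_n.+1 -> A) : A :=
  \sum_(i < n) (-1) ^+ i.+1 *: f (contract x i).

Definition hoch_fun n (f : hom A n) (x : 'I_n.+1 -> A) : A :=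
  x ord0 ** f (x \o lift ord0) + face_sum f x
  + (-1) ^+ n.+1 *: (f (x \o lift ord_max) ** x ord_max).

(* The condition k.+1 is the value of the 1-based subscript k, see [with_id]. *)
Definition delta_fun n (k : 'I_N) (f : hom A n) (x : 'I_n -> A) : A :=
  \sum_(i : {ffun 'I_n -> 'I_N.+1} | (\sum_l i l)%N == k.+1)
     f (fun l => dd (i l) (x l))
  - d k (f x).

Definition hoch'_fun n (F : 'I_N -> hom A n) (k : 'I_N) (x : 'I_n.+1 -> A) : A :=
  \sum_(i < N.+1) \sum_(j < N | (i + j.+1)%N == k.+1)
     dd i (x ord0) ** F j (x \o lift ord0)
  + face_sum (F k) x
  + (-1) ^+ n.+1 *: \sum_(i < N) \sum_(j < N.+1 | (i.+1 + j)%N == k.+1)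
     F i (x \o lift ord_max) ** dd j (x ord_max).

Lemma contract_upd n (x : 'I_n.+1 -> A) i (j : 'I_n) :
  exists k (g : A -> A), linear g /\
    forall u, contract [eta x with i |-> u] j = [eta contract x j with k |-> g u].
Proof.
have mE (l : 'I_n) : (lift ord_max l == i) = (l == i :> nat).
  by rewrite -(lift_max l).
have sE (l : 'I_n) : (lift ord0 l == i) = (l.+1 == i :> nat).
  by rewrite -(lift0 l).
have updE u : contract [eta x with i |-> u] j = fun l =>
    if (l < j)%N then if l == i :> nat then u else x (lift ord_max l)
    else if l == j :> nat then
      (if j == i :> nat then u else x (lift ord_max j)) **
      (if j.+1 == i :> nat then u else x (lift ord0 j))
    else if l.+1 == i :> nat then u else x (lift ord0 l).
  by apply/funext => l; rewrite /contract /= !mE !sE.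
case: (ltngtP i j) => [ij|ij|ij].
- have ltin : (i < n)%N by apply: ltn_trans ij _.
  exists (Ordinal ltin), id; split=> // u; rewrite updE; apply/funext => l.
  rewrite /contract /= -!val_eqE /=.
  by do ![case: ifP]=> //; lia.
- have [ij1|ij1] := eqVneq (i : nat) j.+1.
    exists j, (mul_of P (x (lift ord_max j))); split; first exact: mul_linr.
    move=> u; rewrite updE; apply/funext => l; rewrite /contract /= -!val_eqE /=.
    by do ![case: ifP]=> //; lia.
  have ltin : (i.-1 < n)%N by have := ltn_ord i; lia.
  exists (Ordinal ltin), id; split=> // u; rewrite updE; apply/funext => l.
  rewrite /contract /= -!val_eqE /=.
  by do ![case: ifP]=> //; lia.
exists j, (mul_of P ^~ (x (lift ord0 j))); split; first exact: mul_linl.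
move=> u; rewrite updE; apply/funext => l; rewrite /contract /= -!val_eqE /=.
by do ![case: ifP]=> //; lia.
Qed.

Lemma face_sum_lin n (f : hom A n) (x : 'I_n.+1 -> A) i :
  linear (fun u => face_sum f [eta x with i |-> u]).
Proof.
apply: lin_sum => j _; have [k [g [lg E]]] := contract_upd x i j.
by apply: lin_scale => a u v /=; rewrite !E lg; apply: hom_linear.
Qed.

Lemma left_lin n (g : A -> A) (f : hom A n) (x : 'I_n.+1 -> A) i : linear g ->
  linear (fun u => let y := [eta x with i |-> u] in
                   g (y ord0) ** f (y \o lift ord0)).
Proof.
move=> lg; case: (unliftP ord0 i) => [i' ->|->].
  have H u : [eta x with lift ord0 i' |-> u] \o lift ord0 =
             [eta x \o lift ord0 with i' |-> u].
    exact/(upd_inj (h := lift ord0))/lift_inj.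
  move=> a u v /=; rewrite !H.
  by rewrite (hom_linear f (x \o lift ord0) i') mul_linr.
have H u : [eta x with ord0 |-> u] \o lift ord0 = x \o lift ord0.
  by apply: upd_out => l; rewrite eq_sym neq_lift.
by move=> a u v /=; rewrite !H lg mul_linl.
Qed.

Lemma right_lin n (g : A -> A) (f : hom A n) (x : 'I_n.+1 -> A) i : linear g ->
  linear (fun u => let y := [eta x with i |-> u] in
                   f (y \o lift ord_max) ** g (y ord_max)).
Proof.
move=> lg; case: (unliftP ord_max i) => [i' ->|->].
  have H u : [eta x with lift ord_max i' |-> u] \o lift ord_max =
             [eta x \o lift ord_max with i' |-> u].
    exact/(upd_inj (h := lift ord_max))/lift_inj.
  move=> a u v /=; rewrite !H (negPf (neq_lift _ _)).
  by rewrite (hom_linear f (x \o lift ord_max) i') mul_linl.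
have H u : [eta x with ord_max |-> u] \o lift ord_max = x \o lift ord_max.
  by apply: upd_out => l; rewrite eq_sym neq_lift.
by move=> a u v /=; rewrite !H eqxx lg mul_linr.
Qed.

Fact hoch_proof n (f : hom A n) : hoch_fun f \in @multilinear_pred K A n.+1.
Proof.
apply/asboolP => x i; apply: lin_add; first apply: lin_add.
- exact: (left_lin f x i (@lin_id _ A)).
- exact: face_sum_lin.
- exact: (lin_scale _ (right_lin f x i (@lin_id _ A))).
Qed.

Fact delta_proof n k (f : hom A n) : delta_fun k f \in @multilinear_pred K A n.
Proof.
apply/asboolP => x i; apply: lin_add; last first.
  apply: lin_opp => a u v; rewrite -der_lin; congr (d k _).
  exact: hom_linear.
apply: lin_sum => I _.
have H u : (fun l => dd (I l) ([eta x with i |-> u] l)) =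
           [eta (fun l => dd (I l) (x l)) with i |-> dd (I i) u].
  by apply/funext => l /=; case: eqP => [->|].
by move=> a u v /=; rewrite !H dd_lin; apply: hom_linear.
Qed.

Fact hoch'_proof n (F : 'I_N -> hom A n) k :
  hoch'_fun F k \in @multilinear_pred K A n.+1.
Proof.
apply/asboolP => x i; apply: lin_add; first apply: lin_add.
- do 2![apply: lin_sum => ? _]; exact: (left_lin _ x i (dd_lin _)).
- exact: face_sum_lin.
- apply: lin_scale; do 2![apply: lin_sum => ? _].
  exact: (right_lin _ x i (dd_lin _)).
Qed.

Definition hoch n (f : hom A n) : hom A n.+1 := MkHom (hoch_proof f).
Definition delta n k (f : hom A n) : hom A n := MkHom (delta_proof k f).
Definition hoch' n (F : 'I_N -> hom A n) k : hom A n.+1 := MkHom (hoch'_proof F k).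

Definition differential (n : nat) : cochain A N n -> cochain A N n.+1 :=
  match n with
  | 0 => fun _ => 0
  | 1 => fun f => (hoch f, [ffun k => - delta k f])
  | m.+2 => fun c =>
      (hoch c.1, [ffun k => hoch' c.2 k + (-1) ^+ m.+2 *: delta k c.1])
  end.

Lemma hom_eval_linear n (y : 'I_n -> A) : linear (fun f : hom A n => f y).
Proof. by []. Qed.

Lemma face_sum_linear n (x : 'I_n.+1 -> A) :
  linear (fun f : hom A n => face_sum f x).
Proof. apply: lin_sum => i _; exact: (lin_scale _ (hom_eval_linear _)). Qed.

Lemma hoch_linear n : linear (@hoch n).
Proof.
move=> a f g; apply: homP => x; rewrite hom_addE hom_scaleE.
pose H := fun f : hom A n => hoch_fun f x; suff lH : linear H by exact: lH.
apply: lin_add; first apply: lin_add.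
- by move=> b u v; rewrite -mul_linr.
- exact: face_sum_linear.
- by apply: lin_scale => b u v; rewrite -mul_linl.
Qed.

Lemma delta_linear n k : linear (@delta n k).
Proof.
move=> a f g; apply: homP => x; rewrite hom_addE hom_scaleE.
pose H := fun f : hom A n => delta_fun k f x; suff lH : linear H by exact: lH.
apply: lin_add; first by apply: lin_sum => i _; apply: hom_eval_linear.
by apply: lin_opp => b u v; rewrite -der_lin.
Qed.

Lemma hoch'_linear n k : linear (fun F : {ffun 'I_N -> hom A n} => hoch' F k).
Proof.
move=> a f g; apply: homP => x; rewrite hom_addE hom_scaleE.
pose H := fun F : {ffun 'I_N -> hom A n} => hoch'_fun F k x.
suff lH : linear H by exact: lH.
apply: lin_add; first apply: lin_add.
- by do 2![apply: lin_sum => ? _] => b u v; rewrite -mul_linr !ffunE.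
- by move=> b u v; rewrite -face_sum_linear !ffunE.
- apply: lin_scale; do 2![apply: lin_sum => ? _] => b u v.
  by rewrite -mul_linl !ffunE.
Qed.

Lemma differential_linear n : linear (@differential n).
Proof.
case: n => [|[|n]] a f g /=; first by rewrite scaler0 addr0.
- congr pair; first by rewrite hoch_linear.
  by apply/ffunP => k; rewrite !ffunE delta_linear opprD scalerN.
- congr pair; first by rewrite hoch_linear.
  apply/ffunP => k; rewrite !ffunE hoch'_linear delta_linear.
  by rewrite !scalerDr !scalerA mulrC addrACA.
Qed.

Section Cohomology.
Variable n : nat.

Definition cocycle_pred : {pred cochain A N n} := [pred z | differential z == 0].

Fact cocycle_submod_closed : submod_closed cocycle_pred.
Proof.
split=> [|a u v /eqP du /eqP dv]; apply/eqP.
  exact/plin0/differential_linear.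
by rewrite differential_linear du dv scaler0 addr0.
Qed.

HB.instance Definition _ := GRing.isSubmodClosed.Build K (cochain A N n)
  cocycle_pred cocycle_submod_closed.

Record cocycle := Cocycle {
  cocycle_val :> cochain A N n;
  _ : cocycle_val \in cocycle_pred }.

HB.instance Definition _ := [isSub for cocycle_val].
HB.instance Definition _ := [Choice of cocycle by <:].
HB.instance Definition _ := [SubChoice_isSubLmodule of cocycle by <:].

End Cohomology.

Definition is_coboundary n : cochain A N n -> Prop :=
  match n with
  | 0 => fun c => c = 0
  | m.+1 => fun c => exists b : cochain A N m, c = differential b
  end.

Definition coboundary_pred n : {pred cocycle n} :=
  [pred z | `[< is_coboundary (cocycle_val z) >]].

Fact coboundary_zmod_closed n : zmod_closed (@coboundary_pred n).
Proof.
case: n => [|n]; split=> [|u v /asboolP hu /asboolP hv].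
- by apply/asboolP.
- by apply/asboolP; rewrite /= hu hv subr0.
- by apply/asboolP; exists 0; rewrite (plin0 (@differential_linear n)).
- have [[b ub] [c vc]] := (hu, hv); apply/asboolP; exists (b - c).
  by rewrite (plinB _ _ (@differential_linear n)) -ub -vc.
Qed.

HB.instance Definition _ n := GRing.isZmodClosed.Build (cocycle n)
  (@coboundary_pred n) (@coboundary_zmod_closed n).

(* H^n = Z^n / B^n, as an additive group. *)
Definition cohomology n : zmodType := Quotient.quot (@coboundary_pred n).
Definition cohomology_class n (z : cocycle n) : cohomology n :=
  \pi_(Quotient.quot (@coboundary_pred n))%qT z.

End Complex.

Lemma big_conv_nested (V : nmodType) m (s : 'I_m)
    (F : 'I_m -> 'I_m -> 'I_m -> V) :
  \sum_(a < m) \sum_(u < m | (a + u)%N == s)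
     \sum_(i < m) \sum_(j < m | (i + j)%N == u) F a i j
  = \sum_(a < m) \sum_(i < m) \sum_(j < m | (a + i + j)%N == s) F a i j.
Proof.
apply: eq_bigr => a _; rewrite exchange_big /=; apply: eq_bigr => i _.
rewrite (exchange_big_dep xpredT) //= [RHS]big_mkcond /=; apply: eq_bigr => j _.
case: ifP => [/eqP E|E].
  have lt : (i + j < m)%N by have := ltn_ord s; lia.
  rewrite (big_pred1 (Ordinal lt)) // => u.
  by apply/idP/eqP => [h|->] /=; [apply: val_inj => /=|]; lia.
by rewrite big_pred0 // => u; lia.
Qed.

Lemma big_conv_nestedl (V : nmodType) m (s : 'I_m)
    (F : 'I_m -> 'I_m -> 'I_m -> V) :
  \sum_(u < m) \sum_(j < m | (u + j)%N == s)
     \sum_(a < m) \sum_(i < m | (a + i)%N == u) F a i j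
  = \sum_(a < m) \sum_(i < m) \sum_(j < m | (a + i + j)%N == s) F a i j.
Proof.
under eq_bigr => u _ do rewrite exchange_big /=.
rewrite exchange_big /=; apply: eq_bigr => a _.
under eq_bigr => u _ do rewrite exchange_big /=.
rewrite (exchange_big_dep xpredT) //=; apply: eq_bigr => i _.
have [lt|ge] := ltnP (a + i) m.
  by rewrite (big_pred1 (Ordinal lt)).
by rewrite !big_pred0 // => u; have := ltn_ord u; have := ltn_ord s; lia.
Qed.

(* K[[t]]/(t^{n+1}), which is the same as K[t]/(t^{n+1}). *)
Notation trunc_ring K n := {poly %/ ('X^(n.+1) : {poly K})}.

(* A[[t]]/(t^{n+1}): x stands for \sum_(i <= n) t^i x_i. *)
Definition trunc_mod (K : fieldType) (A : lmodType K) (n : nat) : Type :=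
  {ffun 'I_n.+1 -> A}.

Identity Coercion trunc_mod_ffun : trunc_mod >-> finfun_of.

Section TruncMod.
Context (K : fieldType) (A : lmodType K) (n : nat).
Local Notation R := (trunc_ring K n).
Local Notation At := (trunc_mod A n).

HB.instance Definition _ := GRing.Zmodule.copy At {ffun 'I_n.+1 -> A}.

Definition trunc_scale (p : R) (x : At) : At :=
  [ffun s : 'I_n.+1 => \sum_(i < n.+1) \sum_(j < n.+1 | (i + j)%N == s)
                         (p : {poly K})`_i *: x j].

Lemma trunc_modP (x y : At) : (forall s, x s = y s) -> x = y.
Proof. by move=> xy; apply/ffunP. Qed.

Lemma trunc_addE (x y : At) s : (x + y) s = x s + y s.
Proof. by rewrite ffunE. Qed.

Lemma trunc_oppE (x : At) s : (- x) s = - x s.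
Proof. by rewrite ffunE. Qed.

Lemma trunc_mulE (p q : R) (u : 'I_n.+1) : (p * q : {poly K})`_u =
  \sum_(i < n.+1) \sum_(j < n.+1 | (i + j)%N == u)
     (p : {poly K})`_i * (q : {poly K})`_j.
Proof.
rewrite /=; move: (polyn p) (polyn q) => {}p {}q.
rewrite mk_monic_Xn -Pdiv.RingMonic.take_poly_rmodp coef_take_poly ltn_ord coefM.
rewrite (big_ord_widen_cond n.+1 xpredT (fun j => p`_j * q`_(u - j))) ?ltn_ord //.
rewrite big_mkcond /=; apply: eq_bigr => i _; case: ltnP => iu.
  have lt : (u - i < n.+1)%N by have := ltn_ord u; lia.
  rewrite (big_pred1 (Ordinal lt)) // => j.
  by apply/idP/eqP => [h|->] /=; [apply: val_inj => /=|]; lia.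
by rewrite big_pred0 // => j; lia.
Qed.

Lemma trunc_oneE (i : 'I_n.+1) : (1 : R)`_i = (i == 0%N :> nat)%:R :> K.
Proof. by rewrite /= coefC; case: (i : nat). Qed.

Fact trunc_scaleA p q x :
  trunc_scale p (trunc_scale q x) = trunc_scale (p * q) x.
Proof.
apply: trunc_modP => s; rewrite !ffunE.
under eq_bigr => i _ do under eq_bigr => j _ do rewrite ffunE scaler_sumr.
under eq_bigr => i _ do under eq_bigr => j _ do
  under eq_bigr => k _ do rewrite scaler_sumr.
rewrite big_conv_nested.
under [RHS]eq_bigr => u _ do
  under eq_bigr => j _ do rewrite trunc_mulE scaler_suml.
under [RHS]eq_bigr => u _ do
  under eq_bigr => j _ do under eq_bigr => i _ do rewrite scaler_suml.
rewrite big_conv_nestedl.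
by do 3!apply: eq_bigr => ? _; rewrite scalerA.
Qed.

Fact trunc_scale1 : left_id 1 trunc_scale.
Proof.
move=> x; apply: trunc_modP => s; rewrite ffunE big_ord_recl.
rewrite [X in _ + X]big1 ?addr0 => [|i _].
  by rewrite (big_pred1 s) // trunc_oneE scale1r.
by rewrite big1 // => j _; rewrite trunc_oneE scale0r.
Qed.

Fact trunc_scaleDr : right_distributive trunc_scale +%R.
Proof.
move=> p x y; apply: trunc_modP => s; rewrite ffunE trunc_addE !ffunE.
rewrite -big_split; apply: eq_bigr => i _; rewrite -big_split.
by apply: eq_bigr => j _; rewrite trunc_addE scalerDr.
Qed.

Fact trunc_scaleDl x : {morph trunc_scale^~ x : p q / p + q}.
Proof.
move=> p q; apply: trunc_modP => s; rewrite trunc_addE !ffunE.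
rewrite -big_split; apply: eq_bigr => i _; rewrite -big_split.
by apply: eq_bigr => j _; rewrite /= coefD scalerDl.
Qed.

HB.instance Definition _ := GRing.Zmodule_isLmodule.Build R At
  trunc_scaleA trunc_scale1 trunc_scaleDr trunc_scaleDl.

Lemma trunc_scaleE (p : R) (x : At) s : (p *: x) s =
  \sum_(i < n.+1) \sum_(j < n.+1 | (i + j)%N == s) (p : {poly K})`_i *: x j.
Proof. by rewrite ffunE. Qed.

End TruncMod.

Section Deformation.
Context (K : fieldType) (A : lmodType K) (N : nat).

Section Extension.
Context (n : nat) (c : 'I_n.+1 -> cochain A N 2).
Local Notation At := (trunc_mod A n).

(* K[[t]]/(t^{n+1})-(bi)linear extensions of \sum_i t^i mu_i and
   \sum_i t^i d_{k,i}, where c i = (mu_i; d_{1,i}, ..., d_{N,i}). *)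
Definition mul_t (x y : At) : At :=
  [ffun s : 'I_n.+1 => \sum_(p < n.+1) \sum_(q < n.+1)
     \sum_(r < n.+1 | (p + q + r)%N == s) mul_of (c p) (x q) (y r)].

Definition der_t (k : 'I_N) (x : At) : At :=
  [ffun s : 'I_n.+1 => \sum_(p < n.+1) \sum_(q < n.+1 | (p + q)%N == s)
     der_of (c p) k (x q)].

End Extension.

Context (P : asshder A N) (n : nat).

Definition is_deformation m (c : 'I_m.+1 -> cochain A N 2) : Prop :=
  c ord0 = P /\
  @is_asshder (trunc_ring K m) (trunc_mod A m) N (mul_t c) (der_t c).

Record deformation := Deformation {
  def_coef :> 'I_n.+1 -> cochain A N 2;
  deformationP : is_deformation def_coef }.

Definition extend (D : deformation) (c : cochain A N 2) (i : 'I_n.+2) :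
  cochain A N 2 := if unlift ord_max i is Some j then D j else c.

Definition extensible (D : deformation) : Prop :=
  exists c : cochain A N 2, is_deformation (extend D c).

Section Obstruction.
Variable D : deformation.

(* d_{i,q} for 0 <= i <= N, with d_{0,0} = id and d_{0,q} = 0 for q > 0 *)
Definition der0_of (i : 'I_N.+1) (q : 'I_n.+1) (a : A) : A :=
  if unlift ord0 i is Some k then der_of (D q) k a
  else if q == ord0 then a else 0.

Definition ob0 (a b c : A) : A :=
  \sum_(p < n.+1) \sum_(q < n.+1 | [&& 0 < p, 0 < q & p + q == n.+1]%N)
     (mul_of (D p) (mul_of (D q) a b) c - mul_of (D p) a (mul_of (D q) b c)).

Definition ob (k : 'I_N) (a b : A) : A :=
  \sum_(p < n.+1) \sum_(q < n.+1 | [&& 0 < p, 0 < q & p + q == n.+1]%N)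
     der_of (D p) k (mul_of (D q) a b)
  - \sum_(i < N.+1) \sum_(j < N.+1 | (i + j)%N == k.+1)
     \sum_(p < n.+1) \sum_(q < n.+1) \sum_(r < n.+1 | (p + q + r)%N == n.+1)
       mul_of (D p) (der0_of i q a) (der0_of j r b).

End Obstruction.
End Deformation.

Section CochainLinear.
Context (K : fieldType) (A : lmodType K) (N : nat) (c : cochain A N 2).

Lemma mul_of_linl b : linear (mul_of c ^~ b).
Proof.
have E u : mul_of c u b = c.1 [eta tnth [tuple 0; b] with ord0 |-> u].
  by congr (hom_fun _ _); apply/funext => -[[|[|]]] //= H; rewrite !(tnth_nth 0).
by move=> a u v; rewrite !E hom_linear.
Qed.

Lemma mul_of_linr a : linear (mul_of c a).
Proof.
have E u : mul_of c a u = c.1 [eta tnth [tuple a; 0] with ord_max |-> u].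
  by congr (hom_fun _ _); apply/funext => -[[|[|]]] //= H; rewrite !(tnth_nth 0).
by move=> k u v; rewrite !E hom_linear.
Qed.

Lemma der_of_lin k : linear (der_of c k).
Proof.
have E u : der_of c k u = c.2 k [eta tnth [tuple 0] with ord0 |-> u].
  by congr (hom_fun _ _); apply/funext => -[[|]] //= H; rewrite !(tnth_nth 0).
by move=> a u v; rewrite !E hom_linear.
Qed.

End CochainLinear.

Section TruncLinear.
Context (K : fieldType) (A : lmodType K) (n : nat).
Local Notation R := (trunc_ring K n).
Local Notation At := (trunc_mod A n).

Lemma trunc_linP (F : At -> At) :
  (forall x y, F (x + y) = F x + F y) ->
  (forall (p : R) x, F (p *: x) = p *: F x) -> linear F.
Proof. by move=> FD FZ a u v; rewrite FD FZ. Qed.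

Lemma trunc_shift_lin (F : 'I_n.+1 -> At -> At) : (forall p, linear (F p)) ->
  linear (fun x : At => [ffun s : 'I_n.+1 =>
    \sum_(p < n.+1) \sum_(u < n.+1 | (p + u)%N == s) F p x u] : At).
Proof.
move=> lF; apply: trunc_linP => [x y|a x]; apply: trunc_modP => s.
  rewrite trunc_addE !ffunE -big_split; apply: eq_bigr => p _.
  by rewrite -big_split; apply: eq_bigr => u _; rewrite (plinD (lF p)) trunc_addE.
rewrite trunc_scaleE ffunE.
under eq_bigr => p _ do under eq_bigr => u _ do
  rewrite (plinZ _ _ (lF p)) trunc_scaleE.
rewrite big_conv_nested.
under [RHS]eq_bigr => p _ do under eq_bigr => u _ do rewrite ffunE scaler_sumr.
under [RHS]eq_bigr => p _ do under eq_bigr => u _ do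
  under eq_bigr => i _ do rewrite scaler_sumr.
rewrite big_conv_nested exchange_big /=.
by do 2!apply: eq_bigr => ? _; apply: eq_bigl => j; lia.
Qed.

Section Conv.
Context (B : A -> A -> A).
Hypothesis Bl : forall b, linear (B^~ b).
Hypothesis Br : forall a, linear (B a).

Definition conv (x y : At) : At := [ffun s : 'I_n.+1 =>
  \sum_(q < n.+1) \sum_(r < n.+1 | (q + r)%N == s) B (x q) (y r)].

Lemma conv_linl y : linear (conv^~ y).
Proof.
apply: trunc_linP => [x x'|a x]; apply: trunc_modP => s.
  rewrite trunc_addE !ffunE -big_split; apply: eq_bigr => p _.
  by rewrite -big_split; apply: eq_bigr => u _; rewrite trunc_addE (plinD (Bl _)).
rewrite trunc_scaleE ffunE.
under eq_bigr => p _ do under eq_bigr => u _ do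
  rewrite trunc_scaleE (plin_sum _ _ _ (Bl _)).
under eq_bigr => p _ do under eq_bigr => u _ do
  under eq_bigr => i _ do rewrite (plin_sum _ _ _ (Bl _)).
rewrite big_conv_nestedl.
under [RHS]eq_bigr => p _ do under eq_bigr => u _ do rewrite ffunE scaler_sumr.
under [RHS]eq_bigr => p _ do under eq_bigr => u _ do
  under eq_bigr => i _ do rewrite scaler_sumr.
rewrite big_conv_nested.
by do 3!apply: eq_bigr => ? _; rewrite (plinZ _ _ (Bl _)).
Qed.

Lemma conv_linr x : linear (conv x).
Proof.
apply: trunc_linP => [y y'|a y]; apply: trunc_modP => s.
  rewrite trunc_addE !ffunE -big_split; apply: eq_bigr => p _.
  by rewrite -big_split; apply: eq_bigr => u _; rewrite trunc_addE (plinD (Br _)).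
rewrite trunc_scaleE ffunE.
under eq_bigr => p _ do under eq_bigr => u _ do
  rewrite trunc_scaleE (plin_sum _ _ _ (Br _)).
under eq_bigr => p _ do under eq_bigr => u _ do
  under eq_bigr => i _ do rewrite (plin_sum _ _ _ (Br _)).
rewrite big_conv_nested.
under [RHS]eq_bigr => p _ do under eq_bigr => u _ do rewrite ffunE scaler_sumr.
under [RHS]eq_bigr => p _ do under eq_bigr => u _ do
  under eq_bigr => i _ do rewrite scaler_sumr.
rewrite big_conv_nested exchange_big /=.
apply: eq_bigr => i _; apply: eq_bigr => q _; apply: eq_big => [j|j _]; first by lia.
by rewrite (plinZ _ _ (Br _)).
Qed.

End Conv.

Definition trunc_map (f : A -> A) (x : At) : At :=
  [ffun s : 'I_n.+1 => f (x s)].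

Lemma trunc_map_lin f : linear f -> linear (trunc_map f).
Proof.
move=> lf; apply: trunc_linP => [x y|a x]; apply: trunc_modP => s.
  by rewrite trunc_addE !ffunE (plinD lf).
rewrite trunc_scaleE ffunE trunc_scaleE (plin_sum _ _ _ lf).
apply: eq_bigr => i _; rewrite (plin_sum _ _ _ lf).
by apply: eq_bigr => j _; rewrite ffunE (plinZ _ _ lf).
Qed.

Context (N : nat) (c : 'I_n.+1 -> cochain A N 2).

Lemma mul_tE x y : mul_t c x y = [ffun s : 'I_n.+1 =>
  \sum_(p < n.+1) \sum_(u < n.+1 | (p + u)%N == s) conv (mul_of (c p)) x y u].
Proof.
apply/ffunP => s; rewrite !ffunE.
under [RHS]eq_bigr => p _ do under eq_bigr => u _ do rewrite ffunE.
by rewrite big_conv_nested.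
Qed.

Lemma mul_t_linl y : linear (mul_t c ^~ y).
Proof.
pose F (p : 'I_n.+1) x := conv (mul_of (c p)) x y.
have lF p : linear (F p) by apply: conv_linl => b; apply: mul_of_linl.
by move=> a u v; rewrite !mul_tE; apply: (trunc_shift_lin lF).
Qed.

Lemma mul_t_linr x : linear (mul_t c x).
Proof.
pose F (p : 'I_n.+1) y := conv (mul_of (c p)) x y.
have lF p : linear (F p) by apply: conv_linr => b; apply: mul_of_linr.
by move=> a u v; rewrite !mul_tE; apply: (trunc_shift_lin lF).
Qed.

Lemma der_t_lin k : linear (der_t c k).
Proof.
pose F (p : 'I_n.+1) := trunc_map (der_of (c p) k).
have lF p : linear (F p) by apply: trunc_map_lin; apply: der_of_lin.
have E x : der_t c k x = [ffun s : 'I_n.+1 =>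
    \sum_(p < n.+1) \sum_(u < n.+1 | (p + u)%N == s) F p x u].
  apply/ffunP => s; rewrite !ffunE.
  by do 2!apply: eq_bigr => ? _; rewrite ffunE.
by move=> a u v; rewrite !E; apply: (trunc_shift_lin lF).
Qed.

End TruncLinear.

Ltac zmod_cancel :=
  apply/eqP; rewrite -subr_eq0; apply/eqP;
  rewrite ?(opprD, opprB, opprK, oppr0, addr0, add0r);
  rewrite -[LHS]addr0 -?addrA;
  repeat match goal with
  | |- - ?x + _ = 0 => rewrite !(addrCA _ x) addNKr
  | |- ?x + _ = 0 => rewrite !(addrCA _ (- x)) addKr
  end.

Section Identities.
Context (R : comNzRingType) (V : lmodType R) (N : nat).
Context (M : V -> V -> V) (D : 'I_N -> V -> V).
Hypothesis Ml : forall c, linear (M^~ c).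
Hypothesis Mr : forall c, linear (M c).
Hypothesis Dl : forall k, linear (D k).

Local Notation W := (with_id D).

Lemma W_lin i : linear (W i).
Proof. by rewrite /with_id; case: unlift. Qed.

Definition assoc_defect x y z := M (M x y) z - M x (M y z).

Definition leibniz_defect (k : 'I_N.+1) x y := W k (M x y) -
  \sum_(i < N.+1) \sum_(j < N.+1 | (i + j)%N == k) M (W i x) (W j y).

Lemma assoc_defect_lin1 y z : linear (fun x => assoc_defect x y z).
Proof.
apply: lin_add; first exact: lin_comp (Ml z) (Ml y).
exact: lin_opp (Ml _).
Qed.

Lemma assoc_defect_lin2 x z : linear (fun y => assoc_defect x y z).
Proof.
apply: lin_add; first exact: lin_comp (Ml z) (Mr x).
apply: lin_opp; exact: lin_comp (Mr x) (Ml z).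
Qed.

Lemma assoc_defect_lin3 x y : linear (fun z => assoc_defect x y z).
Proof.
apply: lin_add; first exact: Mr.
apply: lin_opp; exact: lin_comp (Mr x) (Mr y).
Qed.

Lemma leibniz_defect_lin1 k y : linear (fun x => leibniz_defect k x y).
Proof.
apply: lin_add; first exact: lin_comp (W_lin k) (Ml y).
apply: lin_opp; do 2![apply: lin_sum => ? _].
exact: (lin_comp (Ml _) (W_lin _)).
Qed.

Lemma leibniz_defect_lin2 k x : linear (fun y => leibniz_defect k x y).
Proof.
apply: lin_add; first exact: lin_comp (W_lin k) (Mr x).
apply: lin_opp; do 2![apply: lin_sum => ? _].
exact: (lin_comp (Mr _) (W_lin _)).
Qed.

Lemma leibniz_defect0 x y : leibniz_defect ord0 x y = 0.
Proof.
rewrite /leibniz_defect big_ord_recl [X in _ - (_ + X)]big1 => [|i _]; last first.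
  by rewrite big_pred0.
rewrite addr0 (big_pred1 ord0) => [|j]; last by rewrite /= -val_eqE.
by rewrite /with_id unlift_none subrr.
Qed.

Lemma assoc_defect_pentagon a b c d :
  M a (assoc_defect b c d) - assoc_defect (M a b) c d
  + assoc_defect a (M b c) d - assoc_defect a b (M c d)
  + M (assoc_defect a b c) d = 0.
Proof.
rewrite /assoc_defect (plinB _ _ (Mr _)) (plinB _ _ (Ml _)).
by zmod_cancel.
Qed.

Lemma assoc_defect_der (k : 'I_N.+1) a b c :
  W k (assoc_defect a b c) =
  \sum_(i < N.+1) \sum_(j < N.+1) \sum_(l < N.+1 | (i + j + l)%N == k)
     assoc_defect (W i a) (W j b) (W l c)
  + leibniz_defect k (M a b) c
  + \sum_(i < N.+1) \sum_(j < N.+1 | (i + j)%N == k)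
      M (leibniz_defect i a b) (W j c)
  - leibniz_defect k a (M b c)
  - \sum_(i < N.+1) \sum_(j < N.+1 | (i + j)%N == k)
      M (W i a) (leibniz_defect j b c).
Proof.
have EL : \sum_(i < N.+1) \sum_(j < N.+1 | (i + j)%N == k)
      M (leibniz_defect i a b) (W j c) =
    \sum_(i < N.+1) \sum_(j < N.+1 | (i + j)%N == k) M (W i (M a b)) (W j c)
  - \sum_(i < N.+1) \sum_(j < N.+1) \sum_(l < N.+1 | (i + j + l)%N == k)
     M (M (W i a) (W j b)) (W l c).
  rewrite -big_conv_nestedl -sumrB; apply: eq_bigr => i _.
  rewrite -sumrB; apply: eq_bigr => j _; rewrite (plinB _ _ (Ml _)).
  rewrite (plin_sum _ _ _ (Ml _)); congr (_ - _); apply: eq_bigr => u _.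
  by rewrite (plin_sum _ _ _ (Ml _)).
have ER : \sum_(i < N.+1) \sum_(j < N.+1 | (i + j)%N == k)
      M (W i a) (leibniz_defect j b c) =
    \sum_(i < N.+1) \sum_(j < N.+1 | (i + j)%N == k) M (W i a) (W j (M b c))
  - \sum_(i < N.+1) \sum_(j < N.+1) \sum_(l < N.+1 | (i + j + l)%N == k)
     M (W i a) (M (W j b) (W l c)).
  rewrite -big_conv_nested -sumrB; apply: eq_bigr => i _.
  rewrite -sumrB; apply: eq_bigr => j _; rewrite (plinB _ _ (Mr _)).
  rewrite (plin_sum _ _ _ (Mr _)); congr (_ - _); apply: eq_bigr => u _.
  by rewrite (plin_sum _ _ _ (Mr _)).
have EA : \sum_(i < N.+1) \sum_(j < N.+1) \sum_(l < N.+1 | (i + j + l)%N == k)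
     assoc_defect (W i a) (W j b) (W l c) =
    \sum_(i < N.+1) \sum_(j < N.+1) \sum_(l < N.+1 | (i + j + l)%N == k)
     M (M (W i a) (W j b)) (W l c)
  - \sum_(i < N.+1) \sum_(j < N.+1) \sum_(l < N.+1 | (i + j + l)%N == k)
     M (W i a) (M (W j b) (W l c)).
  by do 3![rewrite -sumrB; apply: eq_bigr => ? _].
rewrite EL ER EA /assoc_defect (plinB _ _ (W_lin _)) /leibniz_defect.
by zmod_cancel.
Qed.

End Identities.

Section Truncation.
Context (K : fieldType) (A : lmodType K) (N : nat) (P : asshder A N) (n : nat).
Context (D : deformation P n) (c : cochain A N 2).
Local Notation R := (trunc_ring K n.+1).
Local Notation At := (trunc_mod A n.+1).
Local Notation M := (mul_t (extend D c)).
Local Notation Dt := (der_t (extend D c)).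
Local Notation W := (with_id Dt).

Definition truncate (x : At) : trunc_mod A n :=
  [ffun s : 'I_n.+1 => x (lift ord_max s)].

Definition trunc_const m (a : A) : trunc_mod A m :=
  [ffun s => if s == ord0 then a else 0].

Lemma extend_lift i : extend D c (lift ord_max i) = D i.
Proof. by rewrite /extend liftK. Qed.

Lemma extend_max : extend D c ord_max = c.
Proof. by rewrite /extend unlift_none. Qed.

Lemma extend0 : extend D c ord0 = (P : cochain A N 2).
Proof.
have -> : ord0 = lift ord_max ord0 :> 'I_n.+2 by apply: val_inj.
by rewrite extend_lift; case: (deformationP D).
Qed.

Lemma big_ord_lift (V : nmodType) m (Q : pred 'I_m.+1) (F : 'I_m.+1 -> V) :
  \sum_(i | Q i) F i = \sum_(i < m | Q (lift ord_max i)) F (lift ord_max i)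
                       + (if Q ord_max then F ord_max else 0).
Proof.
rewrite big_mkcond big_ord_recr /= [in RHS]big_mkcond /=; congr (_ + _).
have E i : widen_ord (leqnSn m) i = lift ord_max i.
  by apply: val_inj; rewrite [RHS]lift_max.
by apply: eq_bigr => i _; rewrite E.
Qed.

Lemma truncate_mul x y : truncate (M x y) = mul_t D (truncate x) (truncate y).
Proof.
apply/ffunP => s; rewrite !ffunE.
have lmE (l : 'I_n.+1) : lift ord_max l = l :> nat by rewrite lift_max.
have mE : (ord_max : 'I_n.+2) = n.+1 :> nat by [].
have ltn := ltn_ord s.
rewrite big_ord_lift [X in _ + X]big1 ?addr0 => [|q _]; last first.
  by rewrite big_pred0 // => r; rewrite lmE mE; lia.
apply: eq_bigr => p _; rewrite big_ord_lift [X in _ + X]big_pred0 ?addr0.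
  apply: eq_bigr => q _; rewrite big_ord_lift ifF ?addr0.
    by apply: eq_big => [r|r _]; rewrite ?lmE // extend_lift !ffunE.
  by rewrite !lmE mE; lia.
by move=> r; rewrite !lmE mE; lia.
Qed.

Lemma truncate_der k x : truncate (Dt k x) = der_t D k (truncate x).
Proof.
apply/ffunP => s; rewrite !ffunE.
have lmE (l : 'I_n.+1) : lift ord_max l = l :> nat by rewrite lift_max.
have mE : (ord_max : 'I_n.+2) = n.+1 :> nat by [].
have ltn := ltn_ord s.
rewrite big_ord_lift [X in _ + X]big_pred0 ?addr0 => [|q]; last first.
  by rewrite lmE mE; lia.
apply: eq_bigr => p _; rewrite big_ord_lift ifF ?addr0.
  by apply: eq_big => [r|r _]; rewrite ?lmE // extend_lift !ffunE.
by rewrite !lmE mE; lia.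
Qed.

Lemma truncate_with_id i x :
  truncate (W i x) = with_id (der_t D) i (truncate x).
Proof. by rewrite /with_id; case: unlift => // k; apply: truncate_der. Qed.

Lemma truncateB x y : truncate (x - y) = truncate x - truncate y.
Proof. by apply/ffunP => s; rewrite !ffunE. Qed.

Lemma truncateD x y : truncate (x + y) = truncate x + truncate y.
Proof. by apply/ffunP => s; rewrite !ffunE. Qed.

Lemma truncate0 : truncate 0 = 0.
Proof. by apply/ffunP => s; rewrite !ffunE. Qed.

Lemma truncate_assoc_defect x y z : truncate (assoc_defect M x y z) = 0.
Proof.
rewrite truncateB !truncate_mul (ah_mulA (deformationP D).2) subrr //.
Qed.

Lemma truncate_leibniz_defect k x y : truncate (leibniz_defect M Dt k x y) = 0.
Proof.
case: (unliftP ord0 k) => [k' ->|->]; last first.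
  by rewrite leibniz_defect0 truncate0.
rewrite truncateB truncate_with_id truncate_mul {1}/with_id liftK.
rewrite (ah_leibniz (deformationP D).2) (big_morph _ truncateD truncate0).
rewrite -sumrB big1 // => i _; rewrite (big_morph _ truncateD truncate0).
by rewrite -sumrB big1 // => j _; rewrite truncate_mul !truncate_with_id subrr.
Qed.

Lemma truncate_low (x : At) s : truncate x = 0 -> s != ord_max -> x s = 0.
Proof.
move=> /ffunP x0; case: (unliftP ord_max s) => [s' -> _|-> /eqP //].
by have := x0 s'; rewrite !ffunE.
Qed.

Lemma mul_t0 x y : M x y ord0 = mul_of P (x ord0) (y ord0).
Proof.
rewrite ffunE big_ord_recl [X in _ + X]big1 ?addr0 => [|p _]; last first.
  by rewrite big1 // => q _; rewrite big_pred0.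
rewrite big_ord_recl [X in _ + X]big1 ?addr0 => [|q _]; last by rewrite big_pred0.
by rewrite (big_pred1 ord0) ?extend0.
Qed.

Lemma with_id_der_t0 i x : W i x ord0 = with_id (der_of P) i (x ord0).
Proof.
rewrite /with_id; case: unlift => // k.
rewrite ffunE big_ord_recl [X in _ + X]big1 ?addr0 => [|p _]; last first.
  by rewrite big_pred0.
by rewrite (big_pred1 ord0) ?extend0.
Qed.

Lemma mul_t_topl x y : truncate x = 0 ->
  M x y ord_max = mul_of P (x ord_max) (y ord0).
Proof.
move=> x0; rewrite ffunE exchange_big /= (bigD1 ord_max) //= addrC big1 ?add0r.
  rewrite big_ord_recl [X in _ + X]big1 ?addr0 => [|p _]; last first.
    by rewrite big_pred0 // => r; rewrite /= /bump /=; lia.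
  by rewrite (big_pred1 ord0) ?extend0 // => r; rewrite /= -val_eqE /=; lia.
move=> q qn; do 2![apply: big1 => ? _].
by rewrite (truncate_low x0 qn) (plin0 (mul_of_linl _ _)).
Qed.

Lemma mul_t_topr x y : truncate y = 0 ->
  M x y ord_max = mul_of P (x ord0) (y ord_max).
Proof.
move=> y0; rewrite ffunE.
rewrite big_ord_recl [X in _ + X]big1 ?addr0 => [|p _]; last first.
  apply: big1 => q _; apply: big1 => r /eqP E; rewrite (truncate_low y0).
    exact: plin0 (mul_of_linr _ _).
  by rewrite -val_eqE /=; move: E; rewrite /= /bump /=; lia.
rewrite big_ord_recl [X in _ + X]big1 ?addr0 => [|q _]; last first.
  apply: big1 => r /eqP E; rewrite (truncate_low y0).
    exact: plin0 (mul_of_linr _ _).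
  by rewrite -val_eqE /=; move: E; rewrite /= /bump /=; lia.
by rewrite (big_pred1 ord_max) ?extend0.
Qed.

Lemma with_id_der_t_top i x : truncate x = 0 ->
  W i x ord_max = with_id (der_of P) i (x ord_max).
Proof.
move=> x0; rewrite /with_id; case: unlift => // k; rewrite ffunE.
rewrite big_ord_recl [X in _ + X]big1 ?addr0 => [|p _]; last first.
  apply: big1 => r /eqP E; rewrite (truncate_low x0).
    exact: plin0 (der_of_lin _ _).
  by rewrite -val_eqE /=; move: E; rewrite /= /bump /=; lia.
by rewrite (big_pred1 ord_max) ?extend0.
Qed.

Lemma linear_top (T : At -> At) x : linear T -> (forall y, truncate (T y) = 0) ->
  T x ord_max = T (trunc_const n.+1 (x ord0)) ord_max.
Proof.
move=> lT T0.
pose t : R := in_qpoly _ 'X.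
have tE : t = 'X :> {poly K}.
  by rewrite in_qpoly_small // mk_monic_Xn size_polyX size_polyXn.
pose y : At := [ffun s : 'I_n.+2 => x (inord s.+1)].
have E : x = t *: y + trunc_const n.+1 (x ord0).
  apply: trunc_modP => s; rewrite trunc_addE trunc_scaleE ffunE tE.
  rewrite big_ord_recl big1 ?add0r => [|j _]; last by rewrite coefX scale0r.
  rewrite big_ord_recl [X in _ + X + _]big1 ?addr0 => [|i _]; last first.
    by rewrite big1 // => j _; rewrite coefX scale0r.
  case: (unliftP ord0 s) => [s' ->|->]; last first.
    by rewrite big_pred0 // ?add0r // => j.
  rewrite addr0 (big_pred1 (lift ord_max s')) => [|j]; last first.
    have E (l : 'I_n.+1) : lift ord_max l = l :> nat by rewrite lift_max.
    by rewrite -[RHS]/(j == lift ord_max s' :> nat) E.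
  rewrite coefX scale1r ffunE; congr (x _); apply: val_inj.
  have Em : lift ord_max s' = s' :> nat by rewrite lift_max.
  by rewrite Em [RHS]/= inordK // ltnS; apply: ltn_ord.
rewrite {1}E lT trunc_addE trunc_scaleE big_ord_recl.
rewrite [X in X + _ + _]big1 ?add0r => [|j _]; last by rewrite tE coefX scale0r.
rewrite big1 ?add0r // => i _; apply: big1 => j /eqP Ej.
rewrite (truncate_low (T0 _)) ?scaler0 // -val_eqE /=.
by move: Ej; rewrite /= /bump /=; lia.
Qed.

End Truncation.
Section ObstructionCocycle.
Context (K : fieldType) (A : lmodType K) (N : nat) (P : asshder A N) (n : nat).
Variable D : deformation P n.

Local Notation "a ** b" := (mul_of P a b) (at level 40, left associativity).
Local Notation dd := (with_id (der_of P)).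
Local Notation c' := (extend D 0).
Local Notation M := (mul_t c').
Local Notation Dt := (der_t c').
Local Notation W := (with_id Dt).
Local Notation cst := (trunc_const n.+1).

Lemma mul_of0 a b : mul_of (0 : cochain A N 2) a b = 0.
Proof. by []. Qed.

Lemma der_of0 k a : der_of (0 : cochain A N 2) k a = 0.
Proof. by rewrite /der_of ffunE. Qed.

Lemma trunc_const0 (a : A) : cst a ord0 = a.
Proof. by rewrite ffunE. Qed.

Lemma mul_t_constr (x : trunc_mod A n.+1) b s :
  M x (cst b) s = \sum_(p < n.+2) \sum_(q < n.+2 | (p + q)%N == s)
                    mul_of (c' p) (x q) b.
Proof.
rewrite ffunE; apply: eq_bigr => p _; rewrite [RHS]big_mkcond.
apply: eq_bigr => q _; rewrite big_mkcond big_ord_recl /= [X in _ + X]big1 => [|r _].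
  by rewrite addr0 ffunE eqxx addn0.
by case: ifP => // _; rewrite ffunE (plin0 (mul_of_linr _ _)).
Qed.

Lemma mul_t_constl (x : trunc_mod A n.+1) a s :
  M (cst a) x s = \sum_(p < n.+2) \sum_(q < n.+2 | (p + q)%N == s)
                    mul_of (c' p) a (x q).
Proof.
rewrite ffunE; apply: eq_bigr => p _.
rewrite big_ord_recl [X in _ + X]big1 ?addr0 => [|q _].
  by apply: eq_big => [r|r _]; rewrite ?addn0 ?trunc_const0.
by apply: big1 => r _; rewrite ffunE (plin0 (mul_of_linl _ _)).
Qed.

Lemma mul_t_const (a b : A) s : M (cst a) (cst b) s = mul_of (c' s) a b.
Proof.
rewrite mul_t_constl (bigD1 s) //= [X in _ + X]big1 ?addr0 => [|p ps].
  rewrite (big_pred1 ord0) ?trunc_const0 // => q.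
  by rewrite -[RHS]/(q == 0%N :> nat); lia.
apply: big1 => q /eqP E; rewrite ffunE ifF ?(plin0 (mul_of_linr _ _)) //.
by apply/eqP => q0; case/eqP: ps; apply: val_inj; move: E; rewrite q0 addn0.
Qed.

(* Sums of terms of total degree n+1 whose extreme terms vanish. *)
Lemma big_top2 (F : 'I_n.+2 -> 'I_n.+2 -> A) :
  (forall q, F ord_max q = 0) -> (forall p, F p ord_max = 0) ->
  \sum_(p < n.+2) \sum_(q < n.+2 | (p + q)%N == (ord_max : 'I_n.+2)) F p q =
  \sum_(p < n.+1) \sum_(q < n.+1 | [&& 0 < p, 0 < q & p + q == n.+1]%N)
     F (lift ord_max p) (lift ord_max q).
Proof.
move=> F1 F2; have lmE (l : 'I_n.+1) : lift ord_max l = l :> nat by rewrite lift_max.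
have mE : (ord_max : 'I_n.+2) = n.+1 :> nat by [].
rewrite big_ord_lift [X in _ + X]big1 ?addr0 => [|q _]; last exact: F1.
apply: eq_bigr => p _; rewrite big_ord_lift F2 if_same addr0.
apply: eq_bigl => q; rewrite !lmE mE.
by have := ltn_ord p; have := ltn_ord q; lia.
Qed.

Lemma big_top3 (F : 'I_n.+2 -> 'I_n.+2 -> 'I_n.+2 -> A) :
  (forall q r, F ord_max q r = 0) -> (forall p r, F p ord_max r = 0) ->
  (forall p q, F p q ord_max = 0) ->
  \sum_(p < n.+2) \sum_(q < n.+2)
    \sum_(r < n.+2 | (p + q + r)%N == (ord_max : 'I_n.+2)) F p q r =
  \sum_(p < n.+1) \sum_(q < n.+1) \sum_(r < n.+1 | (p + q + r)%N == n.+1)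
     F (lift ord_max p) (lift ord_max q) (lift ord_max r).
Proof.
move=> F1 F2 F3.
have lmE (l : 'I_n.+1) : lift ord_max l = l :> nat by rewrite lift_max.
rewrite big_ord_lift [X in _ + X]big1 ?addr0 => [|q _]; last exact: big1.
apply: eq_bigr => p _; rewrite big_ord_lift [X in _ + X]big1 ?addr0 //.
apply: eq_bigr => q _; rewrite big_ord_lift F3 if_same addr0.
by apply: eq_bigl => r; rewrite !lmE.
Qed.

Lemma ob0_top a b c :
  assoc_defect M (cst a) (cst b) (cst c) ord_max = ob0 D a b c.
Proof.
rewrite /assoc_defect trunc_addE trunc_oppE mul_t_constr mul_t_constl.
under eq_bigr => p _ do under eq_bigr => q _ do rewrite mul_t_const.
under [X in _ - X]eq_bigr => p _ do under eq_bigr => q _ do rewrite mul_t_const.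
rewrite !big_top2.
- rewrite -sumrB; apply: eq_bigr => p _; rewrite -sumrB.
  by apply: eq_bigr => q _; rewrite !extend_lift.
- by move=> q; rewrite extend_max.
- by move=> p; rewrite extend_max mul_of0 (plin0 (mul_of_linr _ _)).
- by move=> q; rewrite extend_max.
- by move=> p; rewrite extend_max mul_of0 (plin0 (mul_of_linl _ _)).
Qed.

Lemma der_t_const k (a : A) s : Dt k (cst a) s = der_of (c' s) k a.
Proof.
rewrite ffunE (bigD1 s) //= [X in _ + X]big1 ?addr0 => [|p ps].
  rewrite (big_pred1 ord0) ?trunc_const0 // => q.
  by rewrite -[RHS]/(q == 0%N :> nat); lia.
apply: big1 => q /eqP E; rewrite ffunE ifF ?(plin0 (der_of_lin _ _)) //.
by apply/eqP => q0; case/eqP: ps; apply: val_inj; move: E; rewrite q0 addn0.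
Qed.

Lemma with_id_const_lift i a q :
  W i (cst a) (lift ord_max q) = der0_of D i q a.
Proof.
rewrite /with_id /der0_of; case: unlift => [k|].
  by rewrite der_t_const extend_lift.
rewrite ffunE; congr (if _ then _ else _).
have E : lift ord_max q = q :> nat by rewrite lift_max.
by rewrite -[LHS]/(lift ord_max q == 0%N :> nat) E.
Qed.

Lemma with_id_const_max i (a : A) : W i (cst a) ord_max = 0.
Proof.
rewrite /with_id; case: unlift => [k|]; last by rewrite ffunE.
by rewrite der_t_const extend_max der_of0.
Qed.

Lemma trunc_sumE m (I : finType) (Q : pred I) (F : I -> trunc_mod A m) s :
  (\sum_(i | Q i) F i) s = \sum_(i | Q i) F i s.
Proof.
by apply: (big_morph (fun x : trunc_mod A m => x s)) => [x y|]; rewrite ffunE.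
Qed.

Lemma ob_top k a b :
  leibniz_defect M Dt (lift ord0 k) (cst a) (cst b) ord_max = ob D k a b.
Proof.
rewrite /leibniz_defect trunc_addE; congr (_ + _).
  rewrite {1}/with_id liftK ffunE.
  under eq_bigr => p _ do under eq_bigr => q _ do rewrite mul_t_const.
  rewrite big_top2.
  - by do 2!apply: eq_bigr => ? _; rewrite !extend_lift.
  - by move=> q; rewrite extend_max der_of0.
  - by move=> p; rewrite extend_max mul_of0 (plin0 (der_of_lin _ _)).
rewrite trunc_oppE trunc_sumE; congr (- _); apply: eq_bigr => i _.
rewrite trunc_sumE; apply: eq_bigr => j _; rewrite ffunE big_top3.
- by do 3!apply: eq_bigr => ? _; rewrite extend_lift !with_id_const_lift.
- by move=> q r; rewrite extend_max.
- by move=> p r; rewrite with_id_const_max (plin0 (mul_of_linl _ _)).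
- by move=> p q; rewrite with_id_const_max (plin0 (mul_of_linr _ _)).
Qed.

Lemma assoc_defect_max x y z : assoc_defect M x y z ord_max =
  ob0 D (x ord0) (y ord0) (z ord0).
Proof.
rewrite -ob0_top.
have Ml := mul_t_linl c'; have Mr := mul_t_linr c'.
rewrite (linear_top x (assoc_defect_lin1 Ml y z)) => [|?]; last first.
  exact: truncate_assoc_defect.
rewrite (linear_top y (assoc_defect_lin2 Ml Mr _ z)) => [|?]; last first.
  exact: truncate_assoc_defect.
rewrite (linear_top z (assoc_defect_lin3 Mr _ _)) // => ?.
exact: truncate_assoc_defect.
Qed.

Lemma leibniz_defect_max k x y : leibniz_defect M Dt (lift ord0 k) x y ord_max =
  ob D k (x ord0) (y ord0).
Proof.
rewrite -ob_top.
have Ml := mul_t_linl c'; have Mr := mul_t_linr c'; have Dl := der_t_lin c'.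
rewrite (linear_top x (leibniz_defect_lin1 Ml Dl _ y)) => [|?]; last first.
  exact: truncate_leibniz_defect.
rewrite (linear_top y (leibniz_defect_lin2 Mr Dl _ _)) // => ?.
exact: truncate_leibniz_defect.
Qed.

Lemma ob0_pentagon a b c d :
  a ** ob0 D b c d - ob0 D (a ** b) c d + ob0 D a (b ** c) d
  - ob0 D a b (c ** d) + ob0 D a b c ** d = 0.
Proof.
have Ml := mul_t_linl c'; have Mr := mul_t_linr c'.
have := assoc_defect_pentagon Ml Mr (cst a) (cst b) (cst c) (cst d).
move/(congr1 (fun x : trunc_mod A n.+1 => x ord_max)).
have T0 := truncate_assoc_defect D 0.
rewrite 4!trunc_addE 2!trunc_oppE (@mul_t_topr _ _ _ _ _ D 0 _ _ (T0 _ _ _)) (@mul_t_topl _ _ _ _ _ D 0 _ _ (T0 _ _ _)).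
rewrite !assoc_defect_max.
by rewrite !mul_t0 !trunc_const0 => ->; rewrite ffunE.
Qed.

Lemma ob_leibniz k a b c :
  der_of P k (ob0 D a b c) =
  \sum_(i < N.+1) \sum_(j < N.+1) \sum_(l < N.+1 | (i + j + l)%N == k.+1)
     ob0 D (dd i a) (dd j b) (dd l c)
  + ob D k (a ** b) c
  + \sum_(i < N) \sum_(j < N.+1 | (i.+1 + j)%N == k.+1) ob D i a b ** dd j c
  - ob D k a (b ** c)
  - \sum_(i < N.+1) \sum_(j < N | (i + j.+1)%N == k.+1) dd i a ** ob D j b c.
Proof.
have Ml := mul_t_linl c'; have Mr := mul_t_linr c'; have Dl := der_t_lin c'.
have T0 := truncate_assoc_defect D 0; have L0 := truncate_leibniz_defect D 0.
have := assoc_defect_der Ml Mr Dl (lift ord0 k) (cst a) (cst b) (cst c).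
move/(congr1 (fun x : trunc_mod A n.+1 => x ord_max)).
rewrite (@with_id_der_t_top _ _ _ _ _ D 0 _ _ (T0 _ _ _)) {1}/with_id liftK assoc_defect_max !trunc_const0.
move=> ->.
rewrite 4!trunc_addE 2!trunc_oppE !leibniz_defect_max !mul_t0 !trunc_const0.
rewrite !trunc_sumE.
congr (_ + _ + _ - _ - _).
- apply: eq_bigr => i _; rewrite trunc_sumE; apply: eq_bigr => j _.
  rewrite trunc_sumE; apply: eq_bigr => l _.
  by rewrite assoc_defect_max !with_id_der_t0 !trunc_const0.
- rewrite big_ord_recl trunc_sumE [X in X + _]big1 ?add0r => [|j _]; last first.
    by rewrite leibniz_defect0 (plin0 (Ml _)) ffunE.
  apply: eq_bigr => i _; rewrite trunc_sumE; apply: eq_bigr => j _.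
  rewrite (@mul_t_topl _ _ _ _ _ D 0 _ _ (L0 _ _ _)) leibniz_defect_max.
  by rewrite with_id_der_t0 !trunc_const0.
- apply: eq_bigr => i _; rewrite trunc_sumE big_mkcond big_ord_recl /=.
  rewrite leibniz_defect0 (plin0 (Mr _)) ffunE if_same add0r -big_mkcond.
  apply: eq_bigr => j _.
  rewrite (@mul_t_topr _ _ _ _ _ D 0 _ _ (L0 _ _ _)) leibniz_defect_max.
  by rewrite with_id_der_t0 !trunc_const0.
Qed.

Lemma ob0_lin1 b c : linear (fun a => ob0 D a b c).
Proof.
do 2![apply: lin_sum => ? _]; apply: lin_add; last first.
  exact: lin_opp (mul_of_linl _ _).
exact: (lin_comp (mul_of_linl _ _) (mul_of_linl _ _)).
Qed.

Lemma ob0_lin2 a c : linear (fun b => ob0 D a b c).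
Proof.
do 2![apply: lin_sum => ? _]; apply: lin_add; last first.
  apply: lin_opp; exact: (lin_comp (mul_of_linr _ _) (mul_of_linl _ _)).
exact: (lin_comp (mul_of_linl _ _) (mul_of_linr _ _)).
Qed.

Lemma ob0_lin3 a b : linear (fun c => ob0 D a b c).
Proof.
do 2![apply: lin_sum => ? _]; apply: lin_add; first exact: mul_of_linr.
apply: lin_opp; exact: (lin_comp (mul_of_linr _ _) (mul_of_linr _ _)).
Qed.

Lemma der0_of_lin i q : linear (der0_of D i q).
Proof.
rewrite /der0_of; case: unlift => [k|]; first exact: der_of_lin.
by case: (q == ord0); [exact: lin_id|exact: lin_zero].
Qed.

Lemma ob_lin1 k b : linear (fun a => ob D k a b).
Proof.
apply: lin_add; first do 2![apply: lin_sum => ? _].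
  exact: (lin_comp (der_of_lin _ _) (mul_of_linl _ _)).
apply: lin_opp; do 5![apply: lin_sum => ? _].
exact: (lin_comp (mul_of_linl _ _) (der0_of_lin _ _)).
Qed.

Lemma ob_lin2 k a : linear (fun b => ob D k a b).
Proof.
apply: lin_add; first do 2![apply: lin_sum => ? _].
  exact: (lin_comp (der_of_lin _ _) (mul_of_linr _ _)).
apply: lin_opp; do 5![apply: lin_sum => ? _].
exact: (lin_comp (mul_of_linr _ _) (der0_of_lin _ _)).
Qed.

Fact ob0_proof :
  (fun x : 'I_3 -> A => ob0 D (x 0) (x 1) (x 2)) \in @multilinear_pred K A 3.
Proof.
apply/asboolP => x [[|[|[|//]]] H].
- exact: (ob0_lin1 (x 1) (x 2)).
- exact: (ob0_lin2 (x 0) (x 2)).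
- exact: (ob0_lin3 (x 0) (x 1)).
Qed.

Fact ob_proof k :
  (fun x : 'I_2 -> A => ob D k (x 0) (x 1)) \in @multilinear_pred K A 2.
Proof.
apply/asboolP => x [[|[|//]] H].
- exact: (ob_lin1 k (x 1)).
- exact: (ob_lin2 k (x 0)).
Qed.

Definition obstruction : cochain A N 3 :=
  (MkHom ob0_proof, [ffun k => MkHom (ob_proof k)]).

Lemma big_ffun3 (V : nmodType) (T : finType) (Q : T -> T -> T -> bool)
    (F : T -> T -> T -> V) :
  \sum_(i : {ffun 'I_3 -> T} | Q (i 0) (i 1) (i 2)) F (i 0) (i 1) (i 2) =
  \sum_i \sum_j \sum_(l | Q i j l) F i j l.
Proof.
under [RHS]eq_bigr => i _ do rewrite pair_big_dep /=.
rewrite pair_big_dep /=.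
pose h (f : {ffun 'I_3 -> T}) := (f 0, (f 1, f 2)).
pose g (t : T * (T * T)) := [ffun l => tnth [tuple t.1; t.2.1; t.2.2] l].
have hb : bijective h.
  exists g => [f|[a [b c]]]; last by rewrite /h !ffunE.
  apply/ffunP => l; rewrite ffunE /=; case: l => [[|[|[|//]]] H] /=;
    by rewrite (tnth_nth (f 0)) /=; congr (f _); apply: val_inj.
by rewrite (reindex h) //; apply: onW_bij.
Qed.

Lemma obstruction_cocycle : obstruction \in @cocycle_pred K A N P 3.
Proof.
have s2 : (-1) ^+ 2 = 1 :> K by rewrite sqrrN expr1n.
have s3 : (-1) ^+ 3 = -1 :> K by rewrite exprS s2 mulr1.
have s4 : (-1) ^+ 4 = 1 :> K by rewrite exprS s3 mulrNN mulr1.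
apply/eqP; congr pair.
  apply: homP => x; rewrite [LHS]/= [RHS]/= /hoch_fun /face_sum.
  have [a [b [c [d ->]]]] : exists a b c d, x = fun i => nth 0 [:: a; b; c; d] i.
    exists (x 0), (x 1), (x 2), (x 3); apply/funext.
    by case=> [[|[|[|[|//]]]] H] /=; congr (x _); apply: val_inj.
  rewrite !big_ord_recl big_ord0 [LHS]/= /contract [LHS]/= [RHS]/=.
  rewrite -[bump 0 0]/1%N -[bump 0 1]/2%N expr1 s2 s3 s4 !scaleN1r !scale1r.
  by rewrite -[RHS](ob0_pentagon a b c d) addr0 !addrA.
apply/ffunP => k; rewrite !ffunE; apply: homP => x.
have [a [b [c ->]]] : exists a b c, x = fun i => nth 0 [:: a; b; c] i.
  exists (x 0), (x 1), (x 2); apply/funext.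
  by case=> [[|[|[|//]]] H] /=; congr (x _); apply: val_inj.
rewrite hom_addE hom_scaleE [X in X + _]/= [X in _ + _ *: X]/=.
rewrite /hoch'_fun /face_sum /delta_fun.
rewrite [X in _ + X + _ + _]big_ord_recl big_ord_recl big_ord0 addr0.
rewrite -[(lift ord0 ord0).+1]/2%N expr1 s2 s3 !scaleN1r scale1r !ffunE.
have F1 (y : 'I_2 -> A) i : [ffun k => MkHom (ob_proof k)] i y = ob D i (y 0) (y 1).
  by rewrite ffunE.
set X1 := \sum_(i < N.+1) \sum_(j < N | (i + j.+1)%N == k.+1) _ _.
set X2 := \sum_(i < N) \sum_(j < N.+1 | (i.+1 + j)%N == k.+1) _ _.
have -> : X1 = \sum_(i < N.+1) \sum_(j < N | (i + j.+1)%N == k.+1)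
    dd i a ** ob D j b c.
  by do 2!apply: eq_bigr => ? _; rewrite F1.
have -> : X2 = \sum_(i < N) \sum_(j < N.+1 | (i.+1 + j)%N == k.+1)
    ob D i a b ** dd j c.
  by do 2!apply: eq_bigr => ? _; rewrite F1.
have -> : \sum_(i : {ffun 'I_3 -> 'I_N.+1} | (\sum_l i l)%N == k.+1)
    MkHom ob0_proof (fun l : 'I_3 => dd (i l) [:: a; b; c]`_l) =
  \sum_(i < N.+1) \sum_(j < N.+1) \sum_(l < N.+1 | (i + j + l)%N == k.+1)
     ob0 D (dd i a) (dd j b) (dd l c).
  rewrite -(big_ffun3 (fun i j l : 'I_N.+1 => (i + j + l)%N == k.+1)
    (fun i j l => ob0 D (dd i a) (dd j b) (dd l c))).
  apply: eq_bigl => i; rewrite !big_ord_recl big_ord0 addn0 addnA.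
  by congr ((_ + _ + _)%N == _); congr (nat_of_ord (i _)); apply: val_inj.
rewrite /= /contract /= ob_leibniz.
by zmod_cancel.
Qed.

Definition obstruction_cocycle_of : cocycle P 3 := Cocycle obstruction_cocycle.

Definition obstruction_class : cohomology P 3 :=
  cohomology_class obstruction_cocycle_of.

End ObstructionCocycle.

(* Main.v *)
(** The multiplication and the derivations attached to [mu_t + t^(n+1) mu_(n+1)]
    and [d_(k,t) + t^(n+1) d_(k,n+1)] differ from those attached to the trivial
    extension [mu_(n+1) = 0], [d_(k,n+1) = 0] only in degree [n+1], by the value
    of the new cochain on constant terms.  The associativity and Leibniz defects
    of an extension therefore vanish below degree [n+1], and in degree [n+1] they
    are the components of [Ob - differential c]. *)

Require Import Defs.
From mathcomp Require Import all_boot all_algebra.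
From mathcomp Require Import boolp zify.

Set Implicit Arguments.
Unset Strict Implicit.
Unset Printing Implicit Defensive.

Import GRing.Theory.
Local Open Scope ring_scope.

(** Two classes agree exactly when the difference of their representatives lies in the subgroup of
    coboundaries; here one representative is the zero cocycle. *)
Lemma cohomology_class_eq0 (K : fieldType) (A : lmodType K) (N : nat)
    (P : asshder A N) m (z : cocycle P m) :
  cohomology_class z = 0 <-> is_coboundary P (cocycle_val z).
Proof.
have -> : 0 = cohomology_class 0 :> cohomology P m by rewrite /cohomology_class raddf0.
split=> [/eqP|/asboolP zB]; last apply/eqP.
  by rewrite -Quotient.idealrBE subr0 => /asboolP.
by rewrite -Quotient.idealrBE subr0.
Qed.

(** Turns the sum over index functions in [delta_fun], in arity two, into the double sum of the
    Leibniz rule. *)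
Lemma big_ffun2 (V : nmodType) (T : finType) (Q : T -> T -> bool)
    (F : T -> T -> V) :
  \sum_(i : {ffun 'I_2 -> T} | Q (i 0) (i 1)) F (i 0) (i 1) =
  \sum_i \sum_(j | Q i j) F i j.
Proof.
rewrite pair_big_dep /=.
pose h (f : {ffun 'I_2 -> T}) := (f 0, f 1).
rewrite [RHS](reindex h) //; apply: onW_bij.
exists (fun t : T * T => [ffun l => tnth [tuple t.1; t.2] l]) => [f|[a b]].
  apply/ffunP => l; rewrite ffunE (tnth_nth (f 0)) /=.
  by case: l => [[|[|//]] H] /=; congr (f _); apply: val_inj.
by rewrite /h !ffunE.
Qed.

Section Extension.
Context (K : fieldType) (A : lmodType K) (N : nat) (P : asshder A N) (n : nat).
Context (D : deformation P n) (c : cochain A N 2).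

Local Notation "a ** b" := (mul_of P a b) (at level 40, left associativity).
Local Notation dd := (with_id (der_of P)).
Local Notation At := (trunc_mod A n.+1).
Local Notation c0 := (extend D 0).
Local Notation M0 := (mul_t c0).
Local Notation W0 := (with_id (der_t c0)).
Local Notation Mc := (mul_t (extend D c)).
Local Notation Wc := (with_id (der_t (extend D c))).

(** The element [t^(n+1) a]. *)
Definition trunc_top (a : A) : At := [ffun s => if s == ord_max then a else 0].

Lemma trunc_topE a : trunc_top a ord_max = a.
Proof. by rewrite ffunE eqxx. Qed.

Lemma trunc_top0 a : trunc_top a ord0 = 0.
Proof. by rewrite ffunE. Qed.

Lemma truncate_top a : truncate (trunc_top a) = 0.
Proof.
apply/ffunP => s; rewrite !ffunE ifF //.
by apply/negbTE; rewrite eq_sym neq_lift.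
Qed.

(** Coefficient of [t^(n+1)] in the family [d_0, ..., d_N]. Since [d_0 = id] is not deformed, index
    [0] gives zero. *)
Definition der_ext (i : 'I_N.+1) (a : A) : A :=
  if unlift ord0 i is Some k then der_of c k a else 0.

Lemma der_ext0 a : der_ext ord0 a = 0.
Proof. by rewrite /der_ext unlift_none. Qed.

Lemma der_ext_lift k a : der_ext (lift ord0 k) a = der_of c k a.
Proof. by rewrite /der_ext liftK. Qed.

Lemma mul_t_extend x y :
  Mc x y = M0 x y + trunc_top (mul_of c (x ord0) (y ord0)).
Proof.
apply: trunc_modP => s; rewrite trunc_addE !ffunE.
rewrite big_ord_lift [in RHS]big_ord_lift !extend_max -addrA; congr (_ + _).
  by apply: eq_bigr => p _; rewrite !extend_lift.
rewrite [X in _ = X + _]big1 ?add0r => [|q _]; last first.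
  by rewrite big1 // => r _; rewrite mul_of0.
(* The new coefficient already has degree [n+1], so only the constant terms of [x] and [y] can meet
   it, and only for [s = ord_max]. *)
rewrite big_ord_recl [X in _ + X]big1 ?addr0 => [|q _]; last first.
  by rewrite big_pred0 // => r; have := ltn_ord s; rewrite /= /bump /=; lia.
rewrite addn0; case: eqP => [->|smax].
  by rewrite (big_pred1 ord0) // => r; rewrite -[X in _ == X]addn0 eqn_add2l.
rewrite big_pred0 // => r; apply/negP => /eqP E; apply: smax; apply: val_inj.
by move: E (ltn_ord s) => /=; lia.
Qed.

Lemma der_t_extend k x :
  der_t (extend D c) k x = der_t c0 k x + trunc_top (der_of c k (x ord0)).
Proof.
apply: trunc_modP => s; rewrite trunc_addE !ffunE.
rewrite big_ord_lift [in RHS]big_ord_lift !extend_max -addrA; congr (_ + _).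
  by apply: eq_bigr => p _; rewrite !extend_lift.
rewrite [X in _ = X + _]big1 ?add0r => [|q _]; last by rewrite der_of0.
case: eqP => [->|smax].
  by rewrite (big_pred1 ord0) // => r; rewrite -[X in _ == X]addn0 eqn_add2l.
rewrite big_pred0 // => r; apply/negP => /eqP E; apply: smax; apply: val_inj.
by move: E (ltn_ord s) => /=; lia.
Qed.

Lemma with_id_der_t_extend i x :
  Wc i x = W0 i x + trunc_top (der_ext i (x ord0)).
Proof.
rewrite /with_id /der_ext; case: unlift => [k|]; first exact: der_t_extend.
by apply: trunc_modP => s; rewrite !ffunE if_same addr0.
Qed.

(** By bilinearity: a factor [t^(n+1) a] meets only the constant term of the other factor, so the
    product of the two top parts vanishes. *)
Lemma mul_t_extend_top x y a b :
  Mc (x + trunc_top a) (y + trunc_top b) ord_max =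
  M0 x y ord_max + mul_of c (x ord0) (y ord0) + a ** y ord0 + x ord0 ** b.
Proof.
rewrite (plinD (mul_t_linl _ _)) !(plinD (mul_t_linr _ _)) !trunc_addE.
rewrite (mul_t_topr _ _ _ (truncate_top b)) !(mul_t_topl _ _ _ (truncate_top a)).
rewrite mul_t_extend trunc_addE !trunc_topE trunc_top0.
by rewrite (plin0 (mul_of_linr _ _)) addr0 addrAC.
Qed.

(** The part of the top coefficient of the associator that is linear in [mu_(n+1)]; it equals minus
    the Hochschild coboundary of [mu_(n+1)]. *)
Definition mul_variation a b e : A :=
  mul_of c a b ** e + mul_of c (a ** b) e - a ** mul_of c b e - mul_of c a (b ** e).

Lemma assoc_defect_extend x y z :
  assoc_defect Mc x y z ord_max =
  ob0 D (x ord0) (y ord0) (z ord0) + mul_variation (x ord0) (y ord0) (z ord0).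
Proof.
rewrite -assoc_defect_max /assoc_defect !trunc_addE !trunc_oppE.
rewrite (mul_t_extend x y) (mul_t_extend y z).
(* The outer factor receives a zero top part so that the two-sided expansion applies. *)
have := mul_t_extend_top (M0 x y) z (mul_of c (x ord0) (y ord0)) 0.
have -> : z + trunc_top 0 = z.
  by apply: trunc_modP => s; rewrite !ffunE if_same addr0.
move=> ->.
have := mul_t_extend_top x (M0 y z) 0 (mul_of c (y ord0) (z ord0)).
have -> : x + trunc_top 0 = x.
  by apply: trunc_modP => s; rewrite !ffunE if_same addr0.
move=> ->; rewrite !mul_t0 (plin0 (mul_linr _ _)) (plin0 (mul_linl _ _)) /mul_variation.
by zmod_cancel.
Qed.

(** The analogous linear part for the Leibniz rule: minus the [k]-th derivation component of the
    differential of [c]. *)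
Definition der_variation (k : 'I_N) a b : A :=
  der_of P k (mul_of c a b) + der_of c k (a ** b)
  - \sum_(i < N.+1) \sum_(j < N.+1 | (i + j)%N == k.+1)
      (mul_of c (dd i a) (dd j b) + der_ext i a ** dd j b + dd i a ** der_ext j b).

Lemma leibniz_defect_extend k x y :
  leibniz_defect Mc (der_t (extend D c)) (lift ord0 k) x y ord_max =
  ob D k (x ord0) (y ord0) + der_variation k (x ord0) (y ord0).
Proof.
rewrite -leibniz_defect_max /leibniz_defect !trunc_addE !trunc_oppE !trunc_sumE.
rewrite with_id_der_t_extend trunc_addE trunc_topE mul_t_extend.
rewrite (plinD (W_lin (der_t_lin _) _)) !trunc_addE.
rewrite (with_id_der_t_top _ _ _ (truncate_top _)) trunc_topE.
rewrite trunc_top0 addr0 mul_t0.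
rewrite [with_id (der_of P) _ _]/with_id /der_ext liftK /der_variation.
under eq_bigr => i _ do rewrite trunc_sumE.
(* Each summand splits into its value for the trivial extension and three terms linear in [c]. *)
under eq_bigr => i _ do under eq_bigr => j _ do
  rewrite !with_id_der_t_extend mul_t_extend_top !with_id_der_t0 -!addrA.
under [X in _ - X = _]eq_bigr => i _ do rewrite big_split.
under [X in _ = _ - X + _]eq_bigr => i _ do rewrite trunc_sumE.
rewrite big_split /=.
under [X in _ = _ + (_ - X)]eq_bigr => i _ do under eq_bigr => j _ do rewrite -!addrA.
by zmod_cancel.
Qed.

Lemma mul_of_fst (y : 'I_2 -> A) : c.1 y = mul_of c (y 0) (y 1).
Proof.
congr (hom_fun _ _); apply/funext => -[[|[|//]] H] /=;
  by rewrite (tnth_nth 0) /=; congr (y _); apply: val_inj.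
Qed.

Lemma der_of_snd k (y : 'I_1 -> A) : c.2 k y = der_of c k (y 0).
Proof.
congr (hom_fun _ _); apply/funext => -[[|//] H] /=.
by rewrite (tnth_nth 0) /=; congr (y _); apply: val_inj.
Qed.

Lemma hoch_mul_variation (x : 'I_3 -> A) :
  hoch P c.1 x = - mul_variation (x 0) (x 1) (x 2).
Proof.
(* With the arguments stored in an explicit list, the contracted tuples reduce by computation. *)
have [a [b [e ->]]] : exists a b e, x = fun i => nth 0 [:: a; b; e] i.
  exists (x 0), (x 1), (x 2); apply/funext.
  by case=> [[|[|[|//]]] H] /=; congr (x _); apply: val_inj.
rewrite [LHS]/= /hoch_fun /face_sum !big_ord_recl big_ord0 !mul_of_fst.
rewrite /contract /= -[bump 0 0]/1%N expr1 expr2 exprS expr2 !mulrNN !mulr1.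
rewrite !scaleN1r !scale1r /mul_variation.
by zmod_cancel.
Qed.

Lemma differential_der_variation k (x : 'I_2 -> A) :
  (hoch' P c.2 k + (-1) ^+ 2 *: delta P k c.1) x = - der_variation k (x 0) (x 1).
Proof.
have [a [b ->]] : exists a b, x = fun i => nth 0 [:: a; b] i.
  exists (x 0), (x 1); apply/funext.
  by case=> [[|[|//]] H] /=; congr (x _); apply: val_inj.
rewrite hom_addE hom_scaleE [X in X + _]/= [X in _ + _ *: X]/=.
rewrite /hoch'_fun /face_sum /delta_fun big_ord1 !mul_of_fst !der_of_snd.
rewrite sqrrN expr1n expr1 scaleN1r !scale1r /der_variation.
have -> : \sum_(i : {ffun 'I_2 -> 'I_N.+1} | (\sum_l i l)%N == k.+1)
    c.1 (fun l : 'I_2 => dd (i l) [:: a; b]`_l) =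
  \sum_(i < N.+1) \sum_(j < N.+1 | (i + j)%N == k.+1) mul_of c (dd i a) (dd j b).
  rewrite -(big_ffun2 (fun i j : 'I_N.+1 => (i + j)%N == k.+1)
    (fun i j => mul_of c (dd i a) (dd j b))).
  apply: eq_big => [i|i _]; last exact: mul_of_fst.
  rewrite !big_ord_recl big_ord0 addn0.
  by congr ((_ + _)%N == _); congr (nat_of_ord (i _)); apply: val_inj.
set X1 := \sum_(i < N.+1) \sum_(j < N | (i + j.+1)%N == k.+1) _.
set X2 := \sum_(i < N) _.
(* The primed coboundary starts at subscript [1] on the side of the cochain; the index [0] can be
   added because [der_ext] vanishes there. *)
have -> : X1 = \sum_(i < N.+1) \sum_(j < N.+1 | (i + j)%N == k.+1)
    dd i a ** der_ext j b.
  apply: eq_bigr => i _; rewrite [RHS]big_mkcond big_ord_recl der_ext0 /=.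
  rewrite (plin0 (mul_linr _ _)) if_same add0r -big_mkcond.
  by apply: eq_bigr => j _; rewrite der_ext_lift der_of_snd.
have -> : X2 = \sum_(i < N.+1) \sum_(j < N.+1 | (i + j)%N == k.+1)
    der_ext i a ** dd j b.
  rewrite big_ord_recl [X in _ = X + _]big1 ?add0r => [|j _]; last first.
    by rewrite der_ext0 (plin0 (mul_linl _ _)).
  do 2!apply: eq_bigr => ? _; rewrite der_ext_lift der_of_snd.
  by congr (der_of c _ _ ** _).
under [X in _ = - (_ - X)]eq_bigr => i _ do rewrite !big_split.
rewrite !big_split /= /contract /=.
by zmod_cancel.
Qed.

Lemma is_deformation_extend :
  is_deformation P (extend D c) <-> obstruction D = differential P c.
Proof.
split=> [[_ [_ _ MA _ DL]]|E].
  congr pair.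
    apply: homP => x; apply/eqP; rewrite -subr_eq0 hoch_mul_variation opprK /=.
    (* Constant elements suffice as test arguments, since the top coefficient of the defect depends
       only on constant terms. *)
    rewrite -(trunc_const0 n (x 0)) -(trunc_const0 n (x 1)) -(trunc_const0 n (x 2)).
    by rewrite -assoc_defect_extend /assoc_defect MA subrr ffunE.
  apply/ffunP => k; rewrite !ffunE; apply: homP => x; apply/eqP.
  rewrite -subr_eq0 differential_der_variation opprK /=.
  rewrite -(trunc_const0 n (x 0)) -(trunc_const0 n (x 1)) -leibniz_defect_extend.
  by rewrite /leibniz_defect {1}/with_id liftK DL subrr ffunE.
have E1 a b e : ob0 D a b e + mul_variation a b e = 0.
  have := congr1 (fun z : cochain A N 3 => z.1 (nth 0 [:: a; b; e])) E.
  by rewrite [X in _ = X]hoch_mul_variation /= => ->; rewrite addNr.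
have E2 k a b : ob D k a b + der_variation k a b = 0.
  have := congr1 (fun z : cochain A N 3 => z.2 k (nth 0 [:: a; b])) E.
  by rewrite /= !ffunE differential_der_variation /= => ->; rewrite addNr.
(* Truncations of the defects vanish because [D] is a deformation of order [n], which leaves only
   the top coefficient to check. *)
have top0 (x : At) : truncate x = 0 -> x ord_max = 0 -> x = 0.
  move=> x0 xm; apply: trunc_modP => s; rewrite [RHS]ffunE.
  by have [->//|sm] := eqVneq s ord_max; apply: truncate_low.
split; first exact: extend0.
split=> [b|a|x y z|k|k x y].
- exact: mul_t_linl.
- exact: mul_t_linr.
- apply/eqP; rewrite eq_sym -subr_eq0; apply/eqP/top0.
    exact: truncate_assoc_defect.
  by rewrite [LHS]assoc_defect_extend.
- exact: der_t_lin.
- have := top0 _ (truncate_leibniz_defect D c (lift ord0 k) x y).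
  rewrite leibniz_defect_extend => /(_ (E2 _ _ _)) /eqP.
  by rewrite /leibniz_defect {1}/with_id liftK subr_eq0 => /eqP.
Qed.

End Extension.

Theorem theorem6p8 (K : fieldType) (charK : [pchar K] =i pred0)
  (N : nat) (hN : (1 <= N)%N) (A : lmodType K) (P : asshder A N)
  (n : nat) (D : deformation P n) :
  extensible D <-> obstruction_class D = 0.
Proof.
(* A cochain bounding the obstruction is precisely an extending cochain, so the same witness serves
   both directions. *)
rewrite cohomology_class_eq0.
by split=> -[c hc]; exists c; apply/is_deformation_extend.
Qed.
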